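(* Let $q,x\in\mathbb{C}$. For any positive integer $n$, $$\det[q^{|j-k|}+x\delta_{jk}]_{1\le j,k\le n}=(x+1)\,u_n\big(1-q^2+(1+q^2)x,\ q^2x^2\big)-q^2x^2\,u_{n-1}\big(1-q^2+(1+q^2)x,\ q^2x^2\big),$$ where $\delta_{jk}$ is $1$ if $j=k$ and $0$ otherwise.
   Context: For $a,b\in\mathbb{C}$, the Lucas sequence $(u_n(a,b))_{n\ge0}$ is defined by $u_0(a,b)=0$, $u_1(a,b)=1$, and $u_{n+1}(a,b)=au_n(a,b)-bu_{n-1}(a,b)$ for $n\ge1$. The convention $0^0=1$ is used. *)

(* Defs.v *)
From mathcomp Require Import all_boot all_order all_algebra.
From mathcomp Require Import reals complex.

Set Implicit Arguments.
Unset Strict Implicit.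
Unset Printing Implicit Defensive.

Import GRing.Theory.
Local Open Scope ring_scope.

Fixpoint lucas (A : pzRingType) (a b : A) (n : nat) : A :=
  match n with
  | 0 => 0
  | 1 => 1
  | (m.+1 as k).+1 => a * lucas a b k - b * lucas a b m
  end.

(* Main.v *)
Require Import Defs.
From mathcomp Require Import all_boot all_order all_algebra.
From mathcomp Require Import reals complex.
From mathcomp Require Import ring.

Set Implicit Arguments.
Unset Strict Implicit.
Unset Printing Implicit Defensive.

Import GRing.Theory.
Local Open Scope ring_scope.
Local Open Scope complex_scope.

(** Two Laplace expansions give the continuant recurrence. Only the first row and column need to be
    tridiagonal; the rest of [M] is arbitrary. *)
Lemma det_tridiag_corner (A : comNzRingType) n (M : 'M[A]_n.+2) :
  (forall j : 'I_n, M ord0 (lift ord0 (lift ord0 j)) = 0) ->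
  (forall i : 'I_n, M (lift ord0 (lift ord0 i)) ord0 = 0) ->
  \det M = M ord0 ord0 * \det (row' ord0 (col' ord0 M))
    - M ord0 (lift ord0 ord0) * M (lift ord0 ord0) ord0
      * \det (row' ord0 (col' ord0 (row' ord0 (col' ord0 M)))).
Proof.
move=> row0 col0.
have lift1 : lift (lift ord0 ord0 : 'I_n.+2) (ord0 : 'I_n.+1) = ord0 by exact: val_inj.
rewrite (expand_det_row M ord0) 2!big_ord_recl.
rewrite (big1 _ _ (fun j => _ * _)) => [|j _]; last by rewrite row0 mul0r.
rewrite addr0 /cofactor expr0 mul1r expr1 mulN1r mulrN -mulrA.
(* What remains is the minor without row 0 and column 1. Its first column is that of [M] without the
   top entry, so only the entry from row 1 survives. *)
congr (_ - _ * _); rewrite (expand_det_col _ ord0) big_ord_recl.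
rewrite big1 => [|i _]; last first.
  by rewrite !mxE lift1 col0 mul0r.
rewrite addr0 /cofactor expr0 mul1r !mxE.
rewrite lift1; congr (_ * \det _); apply/matrixP=> i j; rewrite !mxE.
congr (M _ _); exact: val_inj.
Qed.

Lemma distSS m n : `|m.+1 - n.+1|%N = `|m - n|%N.
Proof. exact: (distnDl 1). Qed.

Definition toeplitz_mx (A : comNzRingType) (q x : A) n : 'M[A]_n :=
  \matrix_(j < n, k < n) (q ^+ `|j - k|%N + x * (j == k)%:R).

Lemma row'_col'_toeplitz_mx (A : comNzRingType) (q x : A) n :
  row' ord0 (col' ord0 (toeplitz_mx q x n.+1)) = toeplitz_mx q x n.
Proof.
apply/matrixP=> i j; rewrite !mxE (inj_eq lift_inj) !lift0.
by rewrite distSS.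
Qed.

(* Conjugating by [1 - q E_01] subtracts [q] times line 1 from line 0, for rows
   and then for columns; this clears the first line beyond its second entry and leaves the lower right
   block unchanged. *)
Lemma det_toeplitz_mxSS (A : comNzRingType) (q x : A) n :
  \det (toeplitz_mx q x n.+2) =
  (1 - q ^+ 2 + (1 + q ^+ 2) * x) * \det (toeplitz_mx q x n.+1)
  - q ^+ 2 * x ^+ 2 * \det (toeplitz_mx q x n).
Proof.
pose i1 : 'I_n.+2 := lift ord0 ord0.
pose U : 'M[A]_n.+2 := 1%:M - q *: delta_mx ord0 i1.
pose T := toeplitz_mx q x n.+2.
have detU : \det U = 1.
  (* [U] is upper unitriangular, whereas [det_trig] expects a lower triangular matrix. *)
  rewrite -det_tr det_trig; last first.
    apply/is_trig_mxP=> i j lt_ij; rewrite !mxE.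
    have /negbTE-> : j != i by rewrite neq_ltn lt_ij orbT.
    have /negbTE-> : j != ord0 by rewrite -lt0n (leq_trans _ lt_ij).
    by rewrite mulr0 subr0.
  rewrite big1 // => i _; rewrite !mxE eqxx.
  by case: eqP => [->|_]; rewrite mulr0 subr0.
have UM (M : 'M[A]_n.+2) i j : (U *m M) i j = M i j - q * (i == ord0)%:R * M i1 j.
  rewrite mulmxBl mul1mx -scalemxAl !mxE (bigD1 i1) //= big1 => [|k /negbTE nk1].
    by rewrite mxE eqxx andbT addr0 mulrA.
  by rewrite mxE nk1 andbF mul0r.
have BE i j : (U *m T *m U^T) i j = T i j - q * (i == ord0)%:R * T i1 j
    - q * (j == ord0)%:R * (T i i1 - q * (i == ord0)%:R * T i1 i1).
  (* Transposing turns the column operation into a row operation, so [UM] serves for both. *)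
  rewrite -[_ *m U^T]trmxK trmx_mul trmxK mxE UM ![(_^T) _ _]mxE.
  by rewrite !UM.
have detB : \det (U *m T *m U^T) = \det T.
  by rewrite !det_mulmx det_tr detU mul1r mulr1.
rewrite -/T -detB det_tridiag_corner; first last.
(* At distance k >= 2 from the corner the entry is q^k - q * q^(k-1) = 0, and no diagonal term in x
   is involved. *)
- move=> i; rewrite BE !mxE /= /bump /= ?addn0 ?add1n ?subn1 /=.
  by rewrite !exprS; ring.
- move=> i; rewrite BE !mxE /= /bump /= ?addn0 ?add1n ?subn1 /=.
  by rewrite !exprS; ring.
have -> : row' ord0 (col' ord0 (U *m T *m U^T)) = toeplitz_mx q x n.+1.
  rewrite -row'_col'_toeplitz_mx; apply/matrixP=> i j.
  rewrite [LHS]mxE [(col' _ _) _ _]mxE BE [RHS]mxE [RHS]mxE.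
  by rewrite /= !(mulr0, mul0r, subr0).
(* The corner entry is (1 + x) - 2 q^2 + q^2 (1 + x), the coefficient of the first term; its two
   neighbours are both q - q (1 + x) = - q x, with product q^2 x^2. *)
rewrite row'_col'_toeplitz_mx !BE !mxE /=.
by rewrite !expr0 !expr1; ring.
Qed.

(** Both sides obey the same second-order linear recurrence, so agreement at sizes 1 and 2 suffices.
    The empty determinant, equal to 1, yields size 2 through the recurrence. *)
Lemma det_toeplitz_mx (A : comNzRingType) (q x : A) n :
  let a := 1 - q ^+ 2 + (1 + q ^+ 2) * x in
  let b := q ^+ 2 * x ^+ 2 in
  \det (toeplitz_mx q x n.+1) = (x + 1) * lucas a b n.+1 - b * lucas a b n.
Proof.
move=> a b; have recD := det_toeplitz_mxSS q x; rewrite -/a -/b in recD.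
have recL m : lucas a b m.+2 = a * lucas a b m.+1 - b * lucas a b m by [].
have D0 : \det (toeplitz_mx q x 0) = 1 by rewrite det_mx00.
have D1 : \det (toeplitz_mx q x 1) = x + 1.
  by rewrite det_mx11 mxE distnn eqxx mulr1 addrC.
pose P m := \det (toeplitz_mx q x m.+1) = (x + 1) * lucas a b m.+1 - b * lucas a b m.
suff [] : P n /\ P n.+1 by [].
(* From here [a] and [b] act as indeterminates: only the recurrences and the initial values
   matter. *)
clearbody a b; elim: n => [|n [IH1 IH2]].
  by rewrite /P recD recL D0 D1 /=; split; ring.
by split=> //; rewrite /P recD IH1 IH2 !recL; ring.
Qed.

Theorem theorem1p3 (R : realType) (q x : R[i]) (n : nat) (hn : (0 < n)%N) :
  \det (\matrix_(j < n, k < n) (q ^+ `|j - k|%N + x * (j == k)%:R)) =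
  (x + 1) * lucas (1 - q ^+ 2 + (1 + q ^+ 2) * x) (q ^+ 2 * x ^+ 2) n
  - q ^+ 2 * x ^+ 2
    * lucas (1 - q ^+ 2 + (1 + q ^+ 2) * x) (q ^+ 2 * x ^+ 2) n.-1.
Proof. by case: n hn => // n _; exact: det_toeplitz_mx. Qed.
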